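(* Let $R$ and $R'$ be rings, and let $M$ and $M'$ be free left modules of rank $2$ over $R$ and $R'$, respectively. Suppose that $R$ satisfies the following two conditions: (i) given $x_1,x_2,\ldots,x_5\in R$ (not necessarily distinct) there exists $x\in R$ such that $x-x_1,x-x_2,\ldots,x-x_5$ are units in $R$; (ii) $2$ is a unit in $R$. Let $\mu:\mathbb{P}(M)\to\mathbb{P}(M')$, $p\mapsto p^\mu$, be a harmonicity preserver, and let $C$ be any connected component of the distant graph $(\mathbb{P}(M),\triangle)$. Then there exist a basis $(a_0,a_1)$ of $M$, a basis $(a_0',a_1')$ of $M'$, and a Jordan homomorphism $\alpha:R\to R'$ such that the restriction of $\mu$ to $C$ admits the following description: the points of $C$ are precisely the points of the form $R(x_0a_0+x_1a_1)$ with $(x_0,x_1)=(1,0)\cdot E(T)$, where $T=(t_1,\ldots,t_n)$ is a finite sequence ($n\ge 0$) of elements of $R$, and for every such finite sequence $T$, $$\big(R(x_0a_0+x_1a_1)\big)^\mu = R'(x_0'a_0'+x_1'a_1'),\quad\text{where}\quad (x_0,x_1)=(1,0)\cdot E(T),\quad (x_0',x_1')=(1,0)\cdot E(T^\alpha),$$ and $T^\alpha=(t_1^\alpha,\ldots,t_n^\alpha)$.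
   Context: All rings are associative (not necessarily commutative) with unit element $1\neq 0$; modules are unital. Mappings are written as exponents: $x^\alpha$ is the image of $x$ under $\alpha$. A free left $R$-module $M$ of rank $2$ is one having a basis with two elements (it is not required that all bases of $M$ have the same number of elements). Bases $(a,b)$ of $M$ are understood to be ordered bases with two elements. An element $a\in M$ is admissible if there is $b\in M$ such that $(a,b)$ is a basis of $M$. The projective line $\mathbb{P}(M)$ is the set of all cyclic submodules $Ra$ with $a\in M$ admissible; its elements are called points. Two points $p,q$ are distant, $p\,\triangle\, q$, if $M=p\oplus q$. The distant graph $(\mathbb{P}(M),\triangle)$ is the undirected graph with vertex set $\mathbb{P}(M)$ and adjacency relation $\triangle$. A quadruple $(p_0,p_1,p_2,p_3)\in\mathbb{P}(M)^4$ is harmonic if there is a basis $(g_0,g_1)$ of $M$ with $p_0=Rg_0$, $p_1=Rg_1$, $p_2=R(g_0+g_1)$, $p_3=R(g_0-g_1)$. The same definitions apply to $M'$ over $R'$. A harmonicity preserver is a mapping $\mathbb{P}(M)\to\mathbb{P}(M')$ (not assumed injective or surjective) taking every harmonic quadruple of $\mathbb{P}(M)$ to a harmonic quadruple of $\mathbb{P}(M')$. For $t\in R$ let $E(t)=\begin{pmatrix} t&1\\-1&0\end{pmatrix}$, and for a finite sequence $T=(t_1,\ldots,t_n)$ let $E(T)=E(t_1)E(t_2)\cdots E(t_n)$, which is the identity matrix for the empty sequence; likewise over $R'$. A Jordan homomorphism $\alpha:R\to R'$ is a mapping with $(x+y)^\alpha=x^\alpha+y^\alpha$, $1^\alpha=1$,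 and $(xyx)^\alpha=x^\alpha y^\alpha x^\alpha$ for all $x,y\in R$. *)

(* Defs.v *)
From mathcomp Require Import all_boot all_algebra.
From mathcomp Require Import classical_sets.
From Stdlib Require Import Relation_Operators.

Set Implicit Arguments.
Unset Strict Implicit.
Unset Printing Implicit Defensive.

Import GRing.Theory.

Local Open Scope ring_scope.
Local Open Scope classical_set_scope.

Section ProjectiveLine.
Variables (R : nzRingType) (M : lmodType R).
Implicit Types a b : M.

Definition is_basis a b : Prop :=
  forall v : M, exists! x : R * R, v = x.1 *: a + x.2 *: b.

(* Existence of one two-element basis: bases of other cardinalities are not
   excluded, and no invariant basis number is assumed. *)
Definition free_rank2 : Prop := exists a b, is_basis a b.

Definition admissible a : Prop := exists b, is_basis a b.

Definition cyclic_submod a : set M := [set x *: a | x in [set: R]].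

Definition projline : set (set M) :=
  [set p : set M | exists2 a, admissible a & p = cyclic_submod a].

Definition distant (p q : set M) : Prop :=
  [set x + y | x in p & y in q] = [set: M] /\ p `&` q = [set 0].

Definition harmonic (p0 p1 p2 p3 : set M) : Prop :=
  exists g0 g1, is_basis g0 g1 /\
    [/\ p0 = cyclic_submod g0, p1 = cyclic_submod g1,
        p2 = cyclic_submod (g0 + g1) & p3 = cyclic_submod (g0 - g1)].

Definition lincomb2 a b (x : 'rV[R]_2) : M :=
  x ord0 ord0 *: a + x ord0 ord_max *: b.

(* [distant] is symmetric, so its reflexive transitive closure is the
   "joined by a path" relation of the undirected distant graph. *)
Definition distant_component (C : set projline) : Prop :=
  exists p : projline,
    C = [set q | clos_refl_trans projline
                   (fun p1 p2 => distant (val p1) (val p2)) p q].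

End ProjectiveLine.

Arguments free_rank2 {R} M.
Arguments projline {R} M _.

Definition harmonicity_preserver (R R' : nzRingType)
    (M : lmodType R) (M' : lmodType R') (mu : projline M -> projline M') : Prop :=
  forall p0 p1 p2 p3 : projline M,
    harmonic (val p0) (val p1) (val p2) (val p3) ->
    harmonic (val (mu p0)) (val (mu p1)) (val (mu p2)) (val (mu p3)).

Definition jordan_hom (R R' : nzRingType) (alpha : R -> R') : Prop :=
  [/\ forall x y, alpha (x + y) = alpha x + alpha y,
      alpha 1 = 1 &
      forall x y, alpha (x * y * x) = alpha x * alpha y * alpha x].

Definition E_mx (R : nzRingType) (t : R) : 'M[R]_2 :=
  \matrix_(i, j) if i == ord0 then (if j == ord0 then t else 1)
                 else (if j == ord0 then -1 else 0).

Definition E_prod (R : nzRingType) (T : seq R) : 'M[R]_2 :=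
  \prod_(t <- T) E_mx t.

Definition E_row (R : nzRingType) (T : seq R) : 'rV[R]_2 :=
  delta_mx ord0 ord0 *m E_prod T.

(* Main.v *)
(* In affine coordinates the midpoint of two points is their fourth harmonic
   point with respect to the point at infinity, so in a suitable frame the map has an
   additive coordinate function [f]. Swapping the two frame vectors (up to sign)
   does not change [f]: the points with coordinates 1, -1, t, t^-1 are harmonic
   whenever t + 1 and t - 1 are units. Hence [f] serves for all frames obtained
   from the first one by the matrices [E t], which yields the description along
   chains of distant points. The relation
   E(x) E(x^-1) E(x) E(y) E(x) E(x^-1) E(x) = E(x y x), read through this
   description, gives f(x y x) = f(x) f(y) f(x) for units x, and the
   parallelogram law for quadratic maps extends it to all x. *)

Require Import Defs.
From mathcomp Require Import all_boot all_algebra.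
From mathcomp Require Import boolp classical_sets.
From Stdlib Require Import Relation_Operators Operators_Properties.

Set Implicit Arguments.
Unset Strict Implicit.
Unset Printing Implicit Defensive.

Import GRing.Theory.

Local Open Scope ring_scope.
Local Open Scope classical_set_scope.

(** * Bases, cyclic submodules and distant points *)

Section Bases.
Variables (R : nzRingType) (M : lmodType R).
Implicit Types (a b v : M) (t : R).

Lemma is_basisP a b :
  is_basis a b <->
  (forall v, exists x y, v = x *: a + y *: b) /\
  (forall x y, x *: a + y *: b = 0 -> x = 0 /\ y = 0).
Proof.
split=> [h|[hs hi] v].
  split=> [v|x y e].
    by have [[x y] [e _]] := h v; exists x, y.
  have [[x' y'] [_ u]] := h 0.
  have e1 := u (x, y) (esym e).
  have : (x', y') = (0, 0) by apply: u; rewrite /= !scale0r addr0.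
  by rewrite e1 => -[-> ->].
have [x [y e]] := hs v.
exists (x, y); split=> // -[x' y'] /= e'.
have [] := hi (x - x') (y - y').
  by rewrite !scalerBl addrACA -opprD -e -e' subrr.
by move=> /subr0_eq -> /subr0_eq ->.
Qed.

Lemma basis_inj a b (x y x' y' : R) : is_basis a b ->
  x *: a + y *: b = x' *: a + y' *: b -> x = x' /\ y = y'.
Proof.
move=> /is_basisP[_ hi] e.
have [] := hi (x - x') (y - y').
  by rewrite !scalerBl addrACA -opprD e subrr.
by move=> /subr0_eq -> /subr0_eq ->.
Qed.

Lemma basis_sym a b : is_basis a b -> is_basis b a.
Proof.
move=> /is_basisP[hs hi]; apply/is_basisP; split=> [v|x y].
  by have [x [y ->]] := hs v; exists y, x; rewrite addrC.
by rewrite addrC => /hi[-> ->].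
Qed.

Lemma basis_shear a b t : is_basis a b -> is_basis a (t *: a + b).
Proof.
move=> /is_basisP[hs hi]; apply/is_basisP; split=> [v|x y].
  have [x [y ->]] := hs v; exists (x - y * t), y.
  by rewrite scalerDr scalerA addrA -scalerDl subrK.
rewrite scalerDr scalerA addrA -scalerDl => /hi[e y0].
by move: e; rewrite y0 mul0r addr0.
Qed.

Lemma basis_scale a b (u w : R) : u * w = 1 -> w * u = 1 ->
  is_basis a b -> is_basis (u *: a) b.
Proof.
move=> uw wu /is_basisP[hs hi]; apply/is_basisP; split=> [v|x y].
  have [x [y ->]] := hs v; exists (x * w), y.
  by rewrite scalerA -mulrA wu mulr1.
rewrite scalerA => /hi[e ->]; split=> //.
by rewrite -[x]mulr1 -uw mulrA e mul0r.
Qed.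

Lemma basis_opp a b : is_basis a b -> is_basis (- a) b.
Proof.
by rewrite -scaleN1r; apply: (basis_scale (w := -1)); rewrite mulrNN mulr1.
Qed.

Lemma basis_E a b t : is_basis a b -> is_basis (t *: a + b) (- a).
Proof. by move=> h; apply/basis_sym/basis_opp/basis_shear. Qed.

Lemma cyclicP a v : cyclic_submod a v <-> exists x, v = x *: a.
Proof. by split=> [[x _ <-]|[x ->]]; exists x. Qed.

Lemma cyclic_self a : cyclic_submod a a.
Proof. by apply/cyclicP; exists 1; rewrite scale1r. Qed.

Lemma cyclic_scale a (u w : R) : w * u = 1 ->
  cyclic_submod (u *: a) = cyclic_submod a.
Proof.
move=> wu; apply/seteqP; split=> v /cyclicP[x ->]; apply/cyclicP.
  by exists (x * u); rewrite scalerA.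
by exists (x * w); rewrite scalerA -mulrA wu mulr1.
Qed.

Lemma cyclic_opp a : cyclic_submod (- a) = cyclic_submod a.
Proof. by rewrite -scaleN1r (@cyclic_scale _ _ (-1)) // mulrNN mulr1. Qed.

Lemma cyclic_affine_inj a b (x y : R) : is_basis a b ->
  cyclic_submod (x *: a + b) = cyclic_submod (y *: a + b) -> x = y.
Proof.
move=> h e; have := cyclic_self (x *: a + b); rewrite e => /cyclicP[k].
rewrite scalerDr scalerA -{1}[b]scale1r => /(basis_inj h)[-> <-].
by rewrite mul1r.
Qed.

Lemma basis_distant a b :
  is_basis a b -> distant (cyclic_submod a) (cyclic_submod b).
Proof.
move=> /is_basisP[hs hi]; split; apply/seteqP; split=> // v.
- have [x [y ->]] := hs v => _.
  exists (x *: a); first by apply/cyclicP; exists x.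
  by exists (y *: b) => //; apply/cyclicP; exists y.
- move=> [/cyclicP[x e] /cyclicP[y e']] /=.
  have [] := hi x (- y); first by rewrite scaleNr -e -e' subrr.
  by rewrite e => -> _; rewrite scale0r.
- by move=> ->; split; apply/cyclicP; exists 0; rewrite scale0r.
Qed.

(** Since [b] lies in the sum, some multiple of [v] equals [t *: a + b]. Any multiple of [v], minus
    its [b]-coordinate times that vector, lies in both submodules and so vanishes. *)
Lemma distant_affine a b v : is_basis a b ->
  distant (cyclic_submod a) (cyclic_submod v) ->
  exists t, cyclic_submod v = cyclic_submod (t *: a + b).
Proof.
move=> /is_basisP[hs hi] [hD hI].
have : [set: M] b by [].
rewrite -hD => -[_ /cyclicP[x ->] [_ /cyclicP[y ->] e]].
exists (- x).
have ey : - x *: a + b = y *: v by rewrite -e scaleNr addKr.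
apply/seteqP; split=> _ /cyclicP[k ->]; apply/cyclicP; last first.
  by exists (k * y); rewrite ey scalerA.
have [p [q ev]] := hs (k *: v).
exists q; apply/subr0_eq; rewrite ey.
have : (cyclic_submod a `&` cyclic_submod v) (k *: v - q *: (y *: v)).
  split; apply/cyclicP.
    exists (p + q * x).
    by rewrite -ey ev scalerDr opprD addrACA subrr addr0 scalerA -scalerBl
      mulrN opprK.
  by exists (k - q * y); rewrite scalerBl scalerA.
by rewrite hI.
Qed.

(** With [g0 = v *: c0] and [g1 = z *: (m *: c0 + c1)], coordinates give [z * x = z * m + v] and
    [z * y = z * m - v]; add these and cancel [z] by a left inverse. *)
Lemma harmonic_midpoint (c0 c1 : M) (m x y : R) : is_basis c0 c1 ->
  harmonic (cyclic_submod c0) (cyclic_submod (m *: c0 + c1))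
    (cyclic_submod (x *: c0 + c1)) (cyclic_submod (y *: c0 + c1)) ->
  x + y = m + m.
Proof.
move=> hc [g0 [g1 [_ [e0 e1 e2 e3]]]].
have := cyclic_self g0; rewrite -e0 => /cyclicP[v ev].
have := cyclic_self g1; rewrite -e1 => /cyclicP[z ez].
have := cyclic_self (m *: c0 + c1); rewrite e1 ez => /cyclicP[w].
rewrite scalerA scalerDr scalerA -{1}[c1]scale1r => /(basis_inj hc)[_ wz].
have := cyclic_self (g0 + g1); rewrite -e2 => /cyclicP[k].
rewrite ev ez !scalerDr !scalerA addrA -scalerDl => /(basis_inj hc)[ex ek].
move: ex; rewrite -ek => ex {k ek}.
have := cyclic_self (g0 - g1); rewrite -e3 => /cyclicP[l].
rewrite ev ez !scalerDr !scalerA opprD addrA -scalerBl -scaleNr.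
move=> /(basis_inj hc)[ey el].
have {}ey : z * y = z * m - v by apply: oppr_inj; rewrite opprB ey -el mulNr.
rewrite -[x + y]mul1r -[m + m]mul1r wz -!mulrA; congr (w * _).
by rewrite !mulrDr -ex ey addrC addrA subrK.
Qed.

(** [g0 + g1] and [g0 - g1] have the same two coordinates in exchanged order, so [k * x = k * y]
    with [k] left invertible. *)
Lemma harmonic_swap (c0 c1 : M) (x y : R) : is_basis c0 c1 ->
  harmonic (cyclic_submod (c0 + c1)) (cyclic_submod (c0 - c1))
    (cyclic_submod (x *: c0 + c1)) (cyclic_submod (c0 + y *: c1)) ->
  x = y.
Proof.
move=> hc [g0 [g1 [_ [e0 e1 e2 e3]]]].
have := cyclic_self g0; rewrite -e0 => /cyclicP[p ep].
have := cyclic_self g1; rewrite -e1 => /cyclicP[q eq].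
have eD : g0 + g1 = (p + q) *: c0 + (p - q) *: c1.
  by rewrite ep eq !scalerDl scalerDr scalerBr scaleNr addrACA.
have eB : g0 - g1 = (p - q) *: c0 + (p + q) *: c1.
  by rewrite ep eq !scalerDl scalerDr scalerBr scaleNr opprB
    [_ - q *: c0]addrC addrACA.
have := cyclic_self (g0 + g1); rewrite -e2 eD => /cyclicP[k].
rewrite scalerDr scalerA => /(basis_inj hc)[ex ek].
have := cyclic_self (g0 - g1); rewrite -e3 eB => /cyclicP[l].
rewrite scalerDr scalerA => /(basis_inj hc)[el ey].
have := cyclic_self (x *: c0 + c1); rewrite e2 eD => /cyclicP[j].
rewrite scalerDr !scalerA -{1}[c1]scale1r => /(basis_inj hc)[_ jk].
by rewrite -[x]mul1r -[y]mul1r jk -!mulrA {1}ek el -ex ey.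
Qed.

Lemma lincomb2_E_nil a b : lincomb2 a b (E_row [::]) = a.
Proof.
rewrite /lincomb2 /E_row /E_prod big_nil mulmx1 !mxE /=.
by rewrite scale1r scale0r addr0.
Qed.

(** The last factor [E_mx t] acts as the frame change from [(a, b)] to [(t *: a + b, - a)].
    Inductions on sequences therefore peel entries from the right and vary the frame. *)
Lemma lincomb2_E_rcons a b T t :
  lincomb2 a b (E_row (rcons T t)) = lincomb2 (t *: a + b) (- a) (E_row T).
Proof.
rewrite /E_row /E_prod -cats1 big_cat big_seq1 mulmxA.
move: (delta_mx _ _ *m _) => r; rewrite /lincomb2.
rewrite !mxE !big_ord_recl !big_ord0 !mxE /= !addr0 mulr1 mulr0 addr0 mulrN1.
rewrite (_ : lift ord0 ord0 = ord_max); last exact: val_inj.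
by rewrite scalerDr scalerA scalerBl scalerN addrAC.
Qed.

End Bases.

(** * Coordinate functions of a map preserving harmonicity *)

Section Coordinates.
Variables (R : unitRingType) (R' : nzRingType) (M : lmodType R).
Variables (M' : lmodType R') (nu : set M -> set M').
Hypothesis hR5 :
  forall x : 'I_5 -> R, exists y : R, forall i, y - x i \is a GRing.unit.
Hypothesis hR2 : (2%:R : R) \is a GRing.unit.
Hypothesis hnu : forall p0 p1 p2 p3 : set M,
  harmonic p0 p1 p2 p3 -> harmonic (nu p0) (nu p1) (nu p2) (nu p3).

Lemma unit_diff (x0 x1 x2 x3 : R) : exists s,
  [/\ s - x0 \is a GRing.unit, s - x1 \is a GRing.unit,
      s - x2 \is a GRing.unit & s - x3 \is a GRing.unit].
Proof.
(* Index 4 lies past the list, where [nth] returns the default [x0]. *)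
have [s hs] := hR5 (fun i : 'I_5 => nth x0 [:: x0; x1; x2; x3] i).
exists s; split.
- by have := hs (inord 0); rewrite inordK.
- by have := hs (inord 1); rewrite inordK.
- by have := hs (inord 2); rewrite inordK.
- by have := hs (inord 3); rewrite inordK.
Qed.

Lemma half_double (x : R) : 2%:R^-1 * x + 2%:R^-1 * x = x.
Proof. by rewrite -mulr2n -(mulr_natl (_ * x)) mulrA divrr // mul1r. Qed.

Lemma harmonic_basis (a b : M) : is_basis a b ->
  harmonic (cyclic_submod a) (cyclic_submod b)
    (cyclic_submod (a + b)) (cyclic_submod (a - b)).
Proof. by move=> h; exists a, b. Qed.

Lemma basis_addsub (a b : M) : is_basis a b -> is_basis (a + b) (a - b).
Proof.
move=> h.
have h1 : is_basis b (a + b).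
  by have := basis_shear 1 (basis_sym h); rewrite scale1r addrC.
have h2 : is_basis (- 2%:R *: b) (a + b).
  by apply: (basis_scale (w := - 2%:R^-1)) h1; rewrite mulrNN ?divrr ?mulVr.
have := basis_shear 1 (basis_sym h2).
by rewrite scale1r scaleNr scaler_nat mulr2n opprD addrA addrK.
Qed.

(** The images of [R(a + b)] and [R(a - b)] are distant, because these points also begin a harmonic
    quadruple; but if [x + x = 0], then [x *: (k0 + k1) = x *: (k0 - k1)] lies in both images. *)
Lemma double_inj (x : R') : free_rank2 M -> x + x = 0 -> x = 0.
Proof.
move=> [a [b h]] x2.
have [g0 [g1 [hg [e0 e1 _ _]]]] := hnu (harmonic_basis (basis_addsub h)).
have [k0 [k1 [/is_basisP[_ hk] [_ _ f0 f1]]]] := hnu (harmonic_basis h).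
have : (cyclic_submod g0 `&` cyclic_submod g1) (x *: (k0 + k1)).
  rewrite -e0 -e1 f0 f1; split; apply/cyclicP; exists x => //.
  by rewrite scalerBr scalerDr -scaleNr (addr0_eq x2).
rewrite (basis_distant hg).2 /= scalerDr => e.
by have [] := hk _ _ e.
Qed.

(** [a0] and [c0] span the points at infinity. The function [f] is an argument so that a single [f]
    can serve many pairs of frames. *)
Definition frame_map (a0 a1 : M) (c0 c1 : M') (f : R -> R') : Prop :=
  [/\ is_basis a0 a1, is_basis c0 c1,
      nu (cyclic_submod a0) = cyclic_submod c0 &
      forall t,
        nu (cyclic_submod (t *: a0 + a1)) = cyclic_submod (f t *: c0 + c1)].

Lemma frame_map_exists (a0 a1 : M) (c0 c1 : M') :
  is_basis a0 a1 -> is_basis c0 c1 ->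
  nu (cyclic_submod a0) = cyclic_submod c0 ->
  nu (cyclic_submod a1) = cyclic_submod c1 ->
  nu (cyclic_submod (a0 + a1)) = cyclic_submod (c0 + c1) ->
  exists f : R -> R',
    [/\ frame_map a0 a1 c0 c1 f, f 1 = 1 & forall x y, f (x + y) = f x + f y].
Proof.
move=> ha hc n0 n1 n2.
have ex t : exists t',
    nu (cyclic_submod (t *: a0 + a1)) = cyclic_submod (t' *: c0 + c1).
  (* Two points spanned by a basis begin a harmonic quadruple, so their images are distant: affine
     points go to affine points. *)
  have [g0 [g1 [hg [e0 e1 _ _]]]] := hnu (harmonic_basis (basis_shear t ha)).
  rewrite e1; apply: (distant_affine hc); rewrite -n0 e0.
  exact: basis_distant.
have [f hf] := choice ex.
have f0 : f 0 = 0.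
  by apply: (cyclic_affine_inj hc); rewrite -hf !scale0r !add0r.
have f1 : f 1 = 1.
  by apply: (cyclic_affine_inj hc); rewrite -hf !scale1r.
have hu m u : u \is a GRing.unit -> f (m + u) + f (m - u) = f m + f m.
  move=> uu; apply: (harmonic_midpoint hc); rewrite -n0 -!hf; apply: hnu.
  (* The sum and the difference of these basis vectors span the points with coordinates [m + u] and
     [m - u]. *)
  have hb : is_basis (u *: a0) (m *: a0 + a1).
    apply: (basis_scale (w := u^-1)); rewrite ?divrr ?mulVr //.
    exact: basis_shear.
  have := harmonic_basis hb.
  rewrite (@cyclic_scale _ _ _ _ u^-1) ?mulVr // addrA -scalerDl [u + m]addrC.
  by rewrite opprD addrA -scalerBl -opprB cyclic_opp -scaleNr opprB
    [a1 + _]addrC.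
(* For arbitrary [u], insert the points [m - u + 2r] and [m + u - 2r] so that only
   the unit half-differences [r], [r - u] and [2r - u] occur. *)
have hmid m u : f (m + u) + f (m - u) = f m + f m.
  have [r [r0 r1 r2 _]] := unit_diff 0 u (2%:R^-1 * u) 0.
  have r2' : r + r - u \is a GRing.unit.
    by rewrite -[u]half_double opprD addrACA -mulr2n -(mulr_natl (r - _))
      unitrMl.
  rewrite subr0 in r0.
  have h1 : f (m + u) + f (m + u - r - r) = f (m + u - r) + f (m + u - r).
    by have := hu (m + u - r) r r0; rewrite subrK.
  have h2 : f (m - u) + f (m - u + r + r) = f (m - u + r) + f (m - u + r).
    by have := hu (m - u + r) r r0; rewrite addrK addrC.
  have h3 : f (m - u + r) + f (m + u - r) = f m + f m.
    by rewrite -(hu m _ r1) opprB !addrA [m + r - u]addrAC.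
  have h4 : f (m + u - r - r) + f (m - u + r + r) = f m + f m.
    rewrite -(hu m _ r2') opprB !addrA opprD !addrA [LHS]addrC.
    by rewrite [m + r + r - u]addrAC [m + r - u]addrAC.
  apply: (addIr (f m + f m)).
  by rewrite -{1}h4 addrACA h1 h2 addrACA [_ + f (m - u + r)]addrC h3.
exists f; split=> // x y.
(* Both [f x + f y] and [f (x + y) + f 0] equal twice the value of [f] at the midpoint of [x] and
   [y]. *)
have := hmid (2%:R^-1 * (x + y)) (2%:R^-1 * (x - y)).
have := hmid (2%:R^-1 * (x + y)) (2%:R^-1 * (x + y)).
rewrite half_double subrr f0 addr0 => ->.
rewrite -mulrDr -mulrBr addrACA subrr addr0 mulrDr half_double.
by rewrite opprB [x + y]addrC addrACA subrr addr0 mulrDr half_double.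
Qed.

(** * One additive coordinate function for all frames *)

Section Frames.
Variable f : R -> R'.
Hypotheses (f1 : f 1 = 1) (fD : forall x y, f (x + y) = f x + f y).

Lemma coord0 : f 0 = 0.
Proof. by apply: (addrI (f 0)); rewrite -fD !addr0. Qed.

Lemma coordN x : f (- x) = - f x.
Proof. by apply: (addrI (f x)); rewrite -fD !subrr coord0. Qed.

Lemma frame_map_shear a0 a1 c0 c1 t : frame_map a0 a1 c0 c1 f ->
  frame_map a0 (t *: a0 + a1) c0 (f t *: c0 + c1) f.
Proof.
move=> [ha hc n0 hf]; split=> [||//|s]; try exact: basis_shear.
by rewrite !addrA -!scalerDl hf fD.
Qed.

(* If [t + 1] and [t - 1] are units then [R(a0 + a1), R(a0 - a1), R(t a0 + a1),
   R(a0 + t a1)] is harmonic, so [f] and the coordinate map of the flipped frame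
   agree at [t]; every ring element is a difference of two such [t]. *)
Lemma frame_map_flip a0 a1 c0 c1 : frame_map a0 a1 c0 c1 f ->
  frame_map a1 (- a0) c1 (- c0) f.
Proof.
move=> [ha hc n0 hf].
have n1 : nu (cyclic_submod a1) = cyclic_submod c1.
  by have := hf 0; rewrite coord0 !scale0r !add0r.
have nN : nu (cyclic_submod (a0 - a1)) = cyclic_submod (c0 - c1).
  have := hf (- 1); rewrite coordN f1 !scaleN1r => e.
  by rewrite -cyclic_opp opprB addrC e -cyclic_opp opprD opprK.
have nP : nu (cyclic_submod (a0 + a1)) = cyclic_submod (c0 + c1).
  by have := hf 1; rewrite f1 !scale1r.
have [g [[ha' hc' n0' hg] g1 gD]] : exists g : R -> R',
    [/\ frame_map a1 (- a0) c1 (- c0) g, g 1 = 1 &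
        forall x y, g (x + y) = g x + g y].
  apply: frame_map_exists => //.
  - exact/basis_sym/basis_opp.
  - exact/basis_sym/basis_opp.
  - by rewrite !cyclic_opp.
  - by rewrite -cyclic_opp opprB nN -cyclic_opp opprB.
have gN x : g (- x) = - g x.
  have g0 : g 0 = 0 by apply: (addrI (g 0)); rewrite -gD !addr0.
  by apply: (addrI (g x)); rewrite -gD !subrr g0.
have fg t : t + 1 \is a GRing.unit -> t - 1 \is a GRing.unit -> f t = g t.
  move=> tp tm; apply: (harmonic_swap hc).
  (* In the flipped frame [R(a0 + t a1)] has coordinate [- t], so oddness of [g] enters. *)
  have -> : cyclic_submod (c0 + g t *: c1) = nu (cyclic_submod (a0 + t *: a1)).
    rewrite -(cyclic_opp (a0 + _)) opprD -scaleNr [- a0 + _]addrC hg gN.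
    by rewrite scaleNr -opprD cyclic_opp addrC.
  rewrite -nP -nN -hf; apply: hnu.
  (* The weights make the sum and the difference of the two vectors equal to twice [t *: a0 + a1]
     and twice [a0 + t *: a1]. *)
  have hb : is_basis ((t + 1) *: (a0 + a1)) ((t - 1) *: (a0 - a1)).
    apply: (basis_scale (w := (t + 1)^-1)); rewrite ?divrr ?mulVr //.
    apply/basis_sym/(basis_scale (w := (t - 1)^-1)); rewrite ?divrr ?mulVr //.
    exact/basis_sym/basis_addsub.
  have := harmonic_basis hb.
  rewrite (@cyclic_scale _ _ _ _ (t + 1)^-1) ?mulVr //.
  rewrite (@cyclic_scale _ _ _ _ (t - 1)^-1) ?mulVr //.
  have -> : (t + 1) *: (a0 + a1) + (t - 1) *: (a0 - a1) =
      2%:R *: (t *: a0 + a1).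
    rewrite scalerDl scalerBl !scale1r addrACA -scalerDr opprB.
    rewrite [a0 + a1 + (a0 - a1)]addrACA subrr addr0 [a1 - a0]addrC addrACA
      subrr add0r.
    by rewrite scaler_nat mulr2n addrACA scalerDr.
  have -> : (t + 1) *: (a0 + a1) - (t - 1) *: (a0 - a1) =
      2%:R *: (a0 + t *: a1).
    rewrite scalerDl scalerBl !scale1r opprB [a0 - a1 - _]addrC addrACA
      -scalerBr opprB.
    rewrite [a0 + a1 + (a0 - a1)]addrACA subrr addr0 [a1 - a0]addrC addrACA
      subrr add0r.
    by rewrite scaler_nat mulr2n addrC addrACA scalerDr.
  by rewrite !(@cyclic_scale _ _ _ _ 2%:R^-1) ?mulVr.
have fgE x : f x = g x.
  have [s [s0 s1 s2 s3]] := unit_diff (- 1) 1 (x - 1) (x + 1).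
  have h1 : f s = g s by apply: fg; rewrite // -[1]opprK.
  have h2 : f (s - x) = g (s - x).
    by apply: fg; [move: s2 | move: s3]; rewrite opprD ?opprK addrA.
  by rewrite -[x](subKr s) fD gD h1 coordN gN h2.
by split=> // t; rewrite hg fgE.
Qed.

Lemma frame_map_E a0 a1 c0 c1 t : frame_map a0 a1 c0 c1 f ->
  frame_map (t *: a0 + a1) (- a0) (f t *: c0 + c1) (- c0) f.
Proof. by move=> /(frame_map_shear t)/frame_map_flip. Qed.

Lemma frame_map_path a0 a1 c0 c1 T : frame_map a0 a1 c0 c1 f ->
  nu (cyclic_submod (lincomb2 a0 a1 (E_row T))) =
  cyclic_submod (lincomb2 c0 c1 (E_row (map f T))).
Proof.
elim/last_ind: T => [|T t IH] in a0 a1 c0 c1 *.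
  by move=> [_ _ n0 _]; rewrite !lincomb2_E_nil.
by move=> /(frame_map_E t)/IH; rewrite map_rcons !lincomb2_E_rcons.
Qed.

(** The point [R(- x a0 + a1) = R(x^-1 a1 - a0)] is read in a frame and in its flip; both readings
    use [f]. *)
Lemma frame_map_inv a0 a1 c0 c1 x : frame_map a0 a1 c0 c1 f ->
  x \is a GRing.unit -> f x * f x^-1 = 1.
Proof.
move=> hF xu; have [_ hc _ hf] := hF.
have [_ _ _ /(_ x^-1)] := frame_map_flip hF.
have -> : x^-1 *: a1 - a0 = x^-1 *: (- x *: a0 + a1).
  by rewrite scalerDr scaleNr scalerN scalerA mulVr // scale1r addrC.
rewrite (@cyclic_scale _ _ _ _ x) ?divrr // hf coordN => e.
have := cyclic_self (- f x *: c0 + c1); rewrite e => /cyclicP[k].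
rewrite addrC scalerDr scalerN !scalerA addrC -scaleNr [_ + - k *: _]addrC.
by rewrite -{1}[c1]scale1r => /(basis_inj hc)[/oppr_inj -> ->].
Qed.

Lemma frame_map_jordan_unit a0 a1 c0 c1 x y : frame_map a0 a1 c0 c1 f ->
  x \is a GRing.unit -> f (x * y * x) = f x * f y * f x.
Proof.
move=> hF xu.
(* Applied over both rings. The letters [z, z', z] turn a frame [(b0, b1)] into [(- z b0, - z' b1)];
   doing so before and after the letter [w] leaves the effect of the single letter [z * w * z]. *)
have lin (S : nzRingType) (N : lmodType S) (b0 b1 : N) (z z' w : S) :
    z * z' = 1 -> z' * z = 1 ->
    lincomb2 b0 b1 (E_row [:: z; z'; z; w; z; z'; z]) = (z * w * z) *: b0 + b1.
  move=> zz' z'z.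
  have -> : [:: z; z'; z; w; z; z'; z] =
      rcons (rcons (rcons (rcons (rcons (rcons (rcons [::] z) z') z) w) z) z') z.
    by [].
  rewrite !lincomb2_E_rcons lincomb2_E_nil.
  have -> : z' *: (z *: b0 + b1) - b0 = z' *: b1.
    by rewrite scalerDr scalerA z'z scale1r addrC addKr.
  have -> : z *: (z' *: b1) - (z *: b0 + b1) = - (z *: b0).
    by rewrite scalerA zz' scale1r opprD addrCA subrr addr0.
  set v := w *: _ - _.
  have -> : z' *: (z *: v - - (z *: b0)) - v = b0.
    by rewrite opprK -scalerDr scalerA z'z scale1r addrC addKr.
  rewrite opprK opprD addrCA subrr addr0 /v scalerBr opprB.
  by rewrite !scalerN opprK !scalerA zz' scale1r addrC.
have := frame_map_path [:: x; x^-1; x; y; x; x^-1; x] hF.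
have fx := frame_map_inv hF xu.
have fx' : f x^-1 * f x = 1.
  by have := frame_map_inv hF (x := x^-1); rewrite invrK unitrV; apply.
have [_ hc _ hf] := hF.
rewrite /= !lin ?mulVr ?divrr // hf; exact: cyclic_affine_inj hc.
Qed.

Lemma frame_map_jordan a0 a1 c0 c1 : frame_map a0 a1 c0 c1 f ->
  jordan_hom f.
Proof.
move=> hF; split=> // x y.
have [ha _ _ _] := hF.
(* The defect [P u u] is quadratic in [u] and vanishes at the units [s], [s - x] and [s + x], so the
   parallelogram law leaves [P x x + P x x = 0]. *)
have [s [s0 s1 s2 _]] := unit_diff 0 x (- x) 0.
pose P u v := f (u * y * v) - f u * f y * f v.
have PDl u v w : P (u + v) w = P u w + P v w.
  by rewrite /P !(mulrDl, fD) opprD addrACA.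
have PDr u v w : P w (u + v) = P w u + P w v.
  by rewrite /P !(mulrDr, fD) opprD addrACA.
have PNl u w : P (- u) w = - P u w.
  by rewrite /P !(mulNr, coordN) opprB opprK addrC.
have PNr u w : P w (- u) = - P w u.
  by rewrite /P !(mulrN, coordN) opprB opprK addrC.
have P0 z : z \is a GRing.unit -> P z z = 0.
  by move=> zu; rewrite /P (frame_map_jordan_unit y hF zu) subrr.
have QD : P (s + x) (s + x) + P (s - x) (s - x) =
    P s s + P s s + (P x x + P x x).
  rewrite !(PDl, PDr, PNl, PNr) addrACA [- (P x s - _)]opprB; congr (_ + _).
    by rewrite addrACA subrr addr0.
  by rewrite [P x x - _]addrC addrACA subrr add0r.
apply/subr0_eq/double_inj; first by exists a0, a1.
move: QD; rewrite subr0 in s0; rewrite opprK in s2.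
by rewrite (P0 _ s0) (P0 _ s1) (P0 _ s2) !add0r => <-.
Qed.

End Frames.
End Coordinates.

(** * Connected components and sequences of ring elements *)

Section Components.
Variables (R : nzRingType) (M : lmodType R).
Implicit Types (p q : projline M) (a : M).

Lemma projline_point a b : is_basis a b -> exists p, val p = cyclic_submod a.
Proof.
move=> h; have hp : projline M (cyclic_submod a) by exists a => //; exists b.
by exists (SigSub (mem_set hp)).
Qed.

Let joined := clos_refl_trans (projline M) (fun p q => distant (val p) (val q)).

(** The first step of a path leads to some [R(t a0 + a1)], which starts a new frame for the rest of
    the path. *)
Lemma joined_E_row p q (a0 a1 : M) : is_basis a0 a1 ->
  val p = cyclic_submod a0 -> joined p q ->
  exists T, val q = cyclic_submod (lincomb2 a0 a1 (E_row T)).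
Proof.
move=> ha ep /clos_rt_rt1n_iff pq; elim: pq a0 a1 ha ep => {p q}.
  by move=> p a0 a1 _ ep; exists [::]; rewrite lincomb2_E_nil.
move=> p r q d _ IH a0 a1 ha ep.
have [b _ er] := set_mem (valP r).
move: d; rewrite ep er => /(distant_affine ha)[t et].
have [||T eq] := IH (t *: a0 + a1) (- a0); first exact: basis_E.
  by rewrite er.
by exists (rcons T t); rewrite lincomb2_E_rcons.
Qed.

Lemma E_row_joined T p (a0 a1 : M) : is_basis a0 a1 ->
  val p = cyclic_submod a0 ->
  exists2 q, joined p q & val q = cyclic_submod (lincomb2 a0 a1 (E_row T)).
Proof.
elim/last_ind: T => [|T t IH] in p a0 a1 * => ha ep.
  by exists p; [exact: rt_refl | rewrite lincomb2_E_nil].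
have [r er] := projline_point (basis_E t ha).
have [q rq eq] := IH r _ _ (basis_E t ha) er.
exists q; last by rewrite lincomb2_E_rcons.
apply: rt_trans rq; apply: rt_step; rewrite ep er.
exact/basis_distant/basis_shear.
Qed.

End Components.

(** * The description on a connected component *)

Theorem theorem1 (R : unitRingType) (R' : nzRingType)
    (M : lmodType R) (M' : lmodType R')
    (hM : free_rank2 M) (hM' : free_rank2 M')
    (hR5 : forall x : 'I_5 -> R, exists y : R, forall i, y - x i \is a GRing.unit)
    (hR2 : (2%:R : R) \is a GRing.unit)
    (mu : projline M -> projline M') (hmu : harmonicity_preserver mu)
    (C : set (projline M)) (hC : distant_component C) :
  exists (a0 a1 : M) (a0' a1' : M') (alpha : R -> R'),
    [/\ is_basis a0 a1, is_basis a0' a1', jordan_hom alpha,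
        [set val p | p in C] =
          [set cyclic_submod (lincomb2 a0 a1 (E_row T)) | T in [set: seq R]] &
        forall (T : seq R) (p : projline M),
          val p = cyclic_submod (lincomb2 a0 a1 (E_row T)) ->
          val (mu p) = cyclic_submod (lincomb2 a0' a1' (E_row (map alpha T)))].
Proof.
(* [mu] is extended to all subsets, with value [set0] off the projective line; harmonicity is still
   preserved because all members of a harmonic quadruple are points. *)
have [nu hnu] : exists nu : set M -> set M', forall p, nu (val p) = val (mu p).
  suff /choice[nu h] : forall s : set M, exists s' : set M',
      forall p : projline M, val p = s -> s' = val (mu p).
    by exists nu => p; apply: h.
  move=> s; case: (pselect (exists p : projline M, val p = s)) => [[p <-]|nP].
    by exists (val (mu p)) => q /val_inj ->.
  by exists set0 => p ep; case: nP; exists p.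
have hnuH p0 p1 p2 p3 : harmonic p0 p1 p2 p3 ->
    harmonic (nu p0) (nu p1) (nu p2) (nu p3).
  move=> h; have [g0 [g1 [hg [e0 e1 e2 e3]]]] := h.
  have [q0 f0] := projline_point hg.
  have [q1 f1] := projline_point (basis_sym hg).
  have [q2 f2] : exists q : projline M, val q = cyclic_submod (g0 + g1).
    apply: (@projline_point _ _ _ g0); apply/basis_sym.
    by have := basis_shear 1 hg; rewrite scale1r.
  have [q3 f3] : exists q : projline M, val q = cyclic_submod (g0 - g1).
    apply: (@projline_point _ _ _ g0); apply/basis_sym.
    have := basis_shear 1 (basis_sym (basis_opp (basis_sym hg))).
    by rewrite scale1r.
  by move: h; rewrite e0 e1 e2 e3 -f0 -f1 -f2 -f3 !hnu; apply: hmu.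
have [p ->] := hC.
have pP : projline M (val p) := set_mem (valP p).
have [a0 [a1 ha] ep] := pP.
(* The image of one harmonic quadruple supplies the target frame, normalised so that coordinates 0
   and 1 correspond. *)
have [c0 [c1 [hc [n0 n1 n2 _]]]] := hnuH _ _ _ _ (harmonic_basis ha).
have [f [hF f1 fD]] := frame_map_exists hR5 hR2 hnuH ha hc n0 n1 n2.
exists a0, a1, c0, c1, f; split=> //.
- exact: (frame_map_jordan hR5 hR2 hnuH f1 fD hF).
- apply/seteqP; split=> v [].
    by move=> q /(joined_E_row ha ep)[T eq] <- {v}; rewrite eq; exists T.
  move=> T _ <- {v}; have [q pq eq] := E_row_joined T ha ep.
  by exists q.
- move=> T q eq; rewrite -hnu eq.
  exact: (frame_map_path hR5 hR2 hnuH f1 fD T hF).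
Qed.
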